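(* Let $n\ge1$, let $(\pi,u)\in\operatorname{Vert}(C_n)$ and let $a,b\in u([n])$. Then $(\pi,u)$ has a rise labelled $(a,b)$ if and only if $\zeta_C(\pi,u)=(\zeta_C(\pi),d_C(\pi,u))$ has a valley labelled $(b,a)$ or $(-a,-b)$. Moreover, $\pi$ begins with a North step and $u(1)=a$ if and only if $\zeta_C(\pi,u)$ has a valley labelled $(a,-a)$.
   Context: Paths: $\mathcal L_{a,b}$ is the set of words in $\{N,E\}$ with $a$ letters $E$ and $b$ letters $N$; $\mathcal B_m$ is the set of words of length $m$ all of whose prefixes have at least as many $N$'s as $E$'s. For a path, $i$ is a rise if its $i$-th $N$ is immediately followed by an $N$; $(i,j)$ is a valley if its $i$-th $E$ is immediately followed by its $j$-th $N$; also, if a ballot path with $i$ East and $j$ North steps ends with an East step, $(i,j+1)$ counts as a valley. For an integer vector $a=(a_1,\dots,a_n)$, $j\ge0$: $\overrightarrow{S}^+_j(a)$ reads $a$ left to right writing $N$ for each entry $j$ and $E$ for each entry $j+1$; $\overleftarrow{S}^+_j(a)$ likewise reading right to left; $\overrightarrow{S}^-_j(a),\overleftarrow{S}^-_j(a)$ likewise with $N$ for entries $-j$ and $E$ for entries $-j-1$. $\mathfrak S_n^C$: bijections $u$ of $\{\pm1,\dots,\pm n\}$ with $u(-i)=-u(i)$. For $\pi\in\mathcal L_{n,n}$, $\lambda_i$ = number of East steps before the $i$-th North step, and $\mu_i=(n+1-i)-\lambda_{n+1-i}$. $\zeta_C(\pi)=\overleftarrow{S}^-_n(\mu)\overrightarrow{S}^+_n(\mu)\cdots\overleftarrow{S}^-_0(\mu)\overrightarrow{S}^+_0(\mu)$.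 $\operatorname{Vert}(C_n)$: pairs $(\pi,u)$, $\pi\in\mathcal L_{n,n}$, $u\in\mathfrak S_n^C$, with $u(i)<u(i+1)$ for every rise $i$ of $\pi$ and $u(1)>0$ if $\pi$ begins with $N$. $d_C(\pi,u)\in\mathfrak S_n^C$: for $i=0,1,\dots,n$, first write $-u(j)$ for all $j$ with $\mu_{n+1-j}=-i$ in decreasing order of $j$, then $u(j)$ for all $j$ with $\mu_{n+1-j}=i+1$ in increasing order of $j$; the resulting sequence is the window $[d_C(\pi,u)(1),\dots,d_C(\pi,u)(n)]$. Labels: a rise $i$ of $(\pi,u)$ is labelled $(u(i),u(i+1))$. For a pair $(\beta,w)$ with $\beta\in\mathcal B_{2n}$, $w\in\mathfrak S_n^C$, a valley $(i,j)$ of $\beta$ is labelled $(w(n+1-i),w(n+1-j))$ if $j\le n$ and $(w(n+1-i),w(n-j))$ if $j>n$, where $w(-k)=-w(k)$. *)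

(* Defs.v *)
From HB Require Import structures.
From mathcomp Require Import all_boot all_order all_algebra.

Set Implicit Arguments.
Unset Strict Implicit.
Unset Printing Implicit Defensive.

Import Order.TTheory GRing.Theory Num.Theory.
Local Open Scope ring_scope.

Definition north : bool := true.
Definition east : bool := false.
Definition step_word := seq bool.

(* The set L_{a,b}: a East steps and b North steps. *)
Definition lattice_path (a b : nat) (p : step_word) : Prop :=
  count_mem east p = a /\ count_mem north p = b.

Definition begins_north (p : step_word) : Prop := exists t, p = north :: t.

(* Steps are numbered from 1: the first North step displayed below is the
   (count_mem north s).+1-th one. *)
Definition rise (p : step_word) (i : nat) : Prop :=
  exists s t, p = s ++ [:: north, north & t] /\ i = (count_mem north s).+1.

Definition inner_valley (p : step_word) (i j : nat) : Prop :=
  exists s t, [/\ p = s ++ [:: east, north & t],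
                  i = (count_mem east s).+1 & j = (count_mem north s).+1].

(* A final East step of a ballot path counts as a valley, as if it were
   followed by one further North step. *)
Definition final_valley (p : step_word) (i j : nat) : Prop :=
  exists s, [/\ p = rcons s east,
                i = count_mem east p & j = (count_mem north p).+1].

Definition ballot_valley (p : step_word) (i j : nat) : Prop :=
  inner_valley p i j \/ final_valley p i j.

Definition pm_interval (n : nat) : pred int :=
  [pred x : int | (0 < `|x|)%N && (`|x| <= n)%N].

(* The group S_n^C.  A signed permutation is carried by a map int -> int whose
   values outside {+-1, ..., +-n} are unconstrained. *)
Definition signed_perm (n : nat) (u : int -> int) : Prop :=
  [/\ {in pm_interval n, forall x, u x \in pm_interval n},
      {in pm_interval n &, injective u},
      {in pm_interval n, forall y, exists2 x, x \in pm_interval n & u x = y}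
    & {in pm_interval n, forall x, u (- x) = - u x}].

(* The set u([n]). *)
Definition window_value (n : nat) (u : int -> int) (a : int) : Prop :=
  exists i : nat, (1 <= i <= n)%N /\ u i%:Z = a.

(* lambda p i is the number of East steps before the i-th North step, 1 <= i. *)
Definition lambda (p : step_word) (i : nat) : nat :=
  nth 0%N [seq count_mem east (take k p)
          | k <- iota 0 (size p) & nth east p k == north] i.-1.

Definition mu (n : nat) (p : step_word) (i : nat) : int :=
  (n + 1 - i)%N%:Z - (lambda p (n + 1 - i))%:Z.

Definition mu_vec (n : nat) (p : step_word) : seq int :=
  [seq mu n p i | i <- iota 1 n].

(* Reads c from left to right, writing N for each entry x, E for each entry y,
   and nothing for the other entries. *)
Definition read (x y : int) (c : seq int) : step_word :=
  pmap (fun z => if z == x then Some north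
                 else if z == y then Some east else None) c.

Definition S_plus_right (j : nat) (c : seq int) : step_word :=
  read j%:Z (j%:Z + 1) c.
Definition S_minus_left (j : nat) (c : seq int) : step_word :=
  read (- j%:Z) (- j%:Z - 1) (rev c).

Definition zetaC (n : nat) (p : step_word) : step_word :=
  flatten [seq S_minus_left j (mu_vec n p) ++ S_plus_right j (mu_vec n p)
          | j <- rev (iota 0 n.+1)].

Definition vertC (n : nat) (p : step_word) (u : int -> int) : Prop :=
  [/\ lattice_path n n p,
      signed_perm n u,
      forall i : nat, rise p i -> u i%:Z < u (i.+1)%:Z
    & begins_north p -> 0 < u 1].

Definition dC_window (n : nat) (p : step_word) (u : int -> int) : seq int :=
  flatten
    [seq [seq - u j%:Z | j <- rev (iota 1 n) & mu n p (n + 1 - j) == - i%:Z]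
         ++ [seq u j%:Z | j <- iota 1 n & mu n p (n + 1 - j) == i%:Z + 1]
    | i <- iota 0 n.+1].

(* The odd map whose values at 1, ..., n are the entries of c. *)
Definition of_window (c : seq int) (k : int) : int :=
  sgz k * nth 0 c `|k|%N.-1.

Definition dC (n : nat) (p : step_word) (u : int -> int) : int -> int :=
  of_window (dC_window n p u).

Definition zetaC_vert (n : nat) (p : step_word) (u : int -> int) :
    step_word * (int -> int) :=
  (zetaC n p, dC n p u).

Definition has_rise_labelled (p : step_word) (u : int -> int) (a b : int) : Prop :=
  exists i : nat, rise p i /\ (u i%:Z, u (i.+1)%:Z) = (a, b).

Definition valley_label (n : nat) (w : int -> int) (i j : nat) : int * int :=
  (w (n%:Z + 1 - i%:Z),
   if (j <= n)%N then w (n%:Z + 1 - j%:Z) else w (n%:Z - j%:Z)).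

(* Meant for bw = (beta, w) with beta a ballot path of length 2n and w a
   signed permutation. *)
Definition has_valley_labelled (n : nat) (bw : step_word * (int -> int))
    (a b : int) : Prop :=
  exists i j : nat,
    ballot_valley bw.1 i j /\ valley_label n bw.2 i j = (a, b).

(* Main.v *)
Require Import Defs.
From mathcomp Require Import all_boot all_order all_algebra.
From mathcomp Require Import zify.
Import Order.TTheory GRing.Theory Num.Theory.
Local Open Scope ring_scope.

(** Put f(k) = mu_(n+1-k) = k - lambda_k.  Then f climbs by at most 1 at each
    step, its rises are exactly its up-steps, f(1) <= 1 and f(n) >= 0.  Attach
    to every step of zeta_C(pi) read off from an entry f(k) the label u(k) if it
    comes from a word S^+ and -u(k) if it comes from a word S^-.  The labels of
    the East steps, and those of the first n North steps, then spell d_C(pi,u)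
    backwards, so the label of a valley is the pair of labels of its two steps.
    An East step labelled by f(k') followed by a North step inside a word S^+_i
    or S^-_i forces f to make a unit climb between two consecutive occurrences
    of two adjacent values, hence a rise; by the same intermediate value
    argument no word ends with an East step, except the last one, S^+_0, when
    f(1) = 1, i.e. when pi begins with a North step. *)

(** * East counts before North steps *)

Definition east_counts (p : step_word) : seq nat :=
  [seq count_mem east (take k p) | k <- iota 0 (size p) & nth east p k == north].
Arguments east_counts : simpl never.

Lemma east_counts_cons (x : bool) (p : step_word) :
  east_counts (x :: p) =
  if x then 0%N :: east_counts p else map S (east_counts p).
Proof.
rewrite /east_counts /= -add1n iotaDl filter_map.
case: x; rewrite /= -?map_comp ?take0 /=; last by apply: eq_map => k.
by congr (_ :: _); apply: eq_map => k.
Qed.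

Lemma size_east_counts (p : step_word) :
  size (east_counts p) = count_mem north p.
Proof.
by elim: p => [|[] p IH] //; rewrite east_counts_cons /= ?(size_map S) IH.
Qed.

Lemma east_counts_cat (s t : step_word) :
  east_counts (s ++ t) =
  east_counts s ++ map (addn (count_mem east s)) (east_counts t).
Proof.
elim: s => [|x s IH]; first by rewrite map_id.
rewrite cat_cons !east_counts_cons IH; case: x => //=.
by rewrite map_cat -map_comp.
Qed.

Lemma east_counts_le (p : step_word) (i : nat) :
  (nth 0 (east_counts p) i <= count_mem east p)%N.
Proof.
elim: p i => [|x p IH] i; first by rewrite nth_nil.
rewrite east_counts_cons; case: x => /=.
  by case: i => //= i; apply: IH.
case: (ltnP i (size (east_counts p))) => hi.
  by rewrite (nth_map 0%N 0%N S) // add1n ltnS.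
by rewrite nth_default // size_map.
Qed.

(** The bound on [i] keeps both indices inside the list: past its end [nth] returns 0 and
    monotonicity may fail. *)
Lemma east_counts_homo (p : step_word) (i : nat) :
  (i.+1 < count_mem north p)%N ->
  (nth 0 (east_counts p) i <= nth 0 (east_counts p) i.+1)%N.
Proof.
elim: p i => [|x p IH] i //; rewrite !east_counts_cons; case: x => /=.
  by case: i => // i; rewrite add1n ltnS => /IH.
rewrite add0n => hi; rewrite !(nth_map 0%N 0%N S) ?size_east_counts ?hi ?(ltnW hi) //.
by rewrite ltnS IH.
Qed.

Lemma begins_northP (p : step_word) :
  (0 < count_mem north p)%N ->
  begins_north p <-> nth 0%N (east_counts p) 0 = 0%N.
Proof.
move=> hp; split=> [[t ->]|]; first by rewrite east_counts_cons.
case: p hp => [|[] p] //= hp; first by exists p.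
by rewrite east_counts_cons /= (nth_map 0%N 0%N S) // size_east_counts.
Qed.

(** Two successive North steps are contiguous exactly when no East step separates them, that is,
    when their East counts agree. *)
Lemma riseP (p : step_word) (i : nat) :
  rise p i.+1 <->
  (i.+1 < count_mem north p)%N /\
  nth 0%N (east_counts p) i.+1 = nth 0%N (east_counts p) i.
Proof.
split=> [[s [t [-> [->]]]]|].
  rewrite count_cat east_counts_cat !east_counts_cons /= -size_east_counts.
  split; first lia.
  by rewrite !nth_cat ltnn subnn ltnNge leqnSn subSnn.
elim: p i => [|x p IH] i [] //; rewrite !east_counts_cons; case: x => /=.
  case: i => [|i] hi e.
    have [t ->] := iffRL (begins_northP p hi) e.
    by exists nil, t.
  have [s [t [-> [->]]]] := IH i (conj hi e).
  by exists (north :: s), t.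
rewrite add0n => hi; rewrite !(nth_map 0%N 0%N S) ?size_east_counts ?hi ?(ltnW hi) // => -[e].
have [s [t [-> [->]]]] := IH i (conj hi e).
by exists (east :: s), t.
Qed.

(** * Levels *)

(* This is [mu_(n+1-k)]; the junk value at [k = 0] is [- lambda_1], which makes
   an initial North step look like a rise at index [0]. *)
Definition level (p : step_word) (k : nat) : int := k%:Z - (lambda p k)%:Z.

Lemma lambdaE (p : step_word) (k : nat) :
  lambda p k = nth 0%N (east_counts p) k.-1.
Proof. by []. Qed.

Lemma mu_level (n : nat) (p : step_word) (k : nat) :
  (k <= n)%N -> mu n p (n + 1 - k) = level p k.
Proof. by move=> hk; rewrite /mu /level; have -> : (n + 1 - (n + 1 - k) = k)%N by lia. Qed.

Lemma mu_vec_level (n : nat) (p : step_word) :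
  mu_vec n p = [seq level p k | k <- rev (iota 1 n)].
Proof.
rewrite /mu_vec map_rev; apply: (@eq_from_nth _ 0); rewrite ?size_rev ?size_map //.
rewrite size_iota => i hi.
rewrite nth_rev ?size_map ?size_iota // !(nth_map 0%N) ?size_iota; try lia.
rewrite !nth_iota; try lia.
by rewrite -(@mu_level n); [congr mu; lia | lia].
Qed.

Lemma level0_le (p : step_word) : level p 0 <= 0.
Proof. by rewrite /level; lia. Qed.

Lemma level_step (n : nat) (p : step_word) (k : nat) :
  lattice_path n n p -> (k < n)%N -> level p k.+1 <= level p k + 1.
Proof.
move=> [_ hN] hk; rewrite /level !lambdaE.
(* [lambda p 0] and [lambda p 1] are the same entry because of the predecessor, so the climb from
   index 0 to index 1 is exactly 1. *)
case: k hk => [|k] hk /=; first lia.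
have := @east_counts_homo p k; rewrite hN => /(_ hk); lia.
Qed.

(** At most [n] East steps precede a North step. The lower bound at [k = n] is what gives f(n) >=
    0. *)
Lemma level_bounds (n : nat) (p : step_word) (k : nat) :
  lattice_path n n p -> (k <= n)%N -> k%:Z - n%:Z <= level p k <= n%:Z.
Proof.
move=> [hE _] hk; rewrite /level lambdaE.
have := east_counts_le p k.-1; rewrite hE; lia.
Qed.

Lemma rise_level (n : nat) (p : step_word) (k : nat) :
  lattice_path n n p ->
  rise p k <-> [/\ (0 < k)%N, (k < n)%N & level p k.+1 = level p k + 1].
Proof.
move=> [_ hN]; case: k => [|k].
  by split=> [[s [t []]]|[]].
rewrite riseP hN /level !lambdaE /=; split=> [[hk e]|[_ hk e]]; split=> //; lia.
Qed.

Lemma begins_north_level (n : nat) (p : step_word) :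
  (0 < n)%N -> lattice_path n n p -> begins_north p <-> level p 1 = 1.
Proof.
move=> hn [_ hN]; rewrite begins_northP ?hN // /level lambdaE /=.
by split=> [->|] //; lia.
Qed.

(* Up-steps have height at most 1, so a sequence that climbs from [<= i] to
   [>= i + 1] makes a unit step from [i] to [i + 1]. *)
Lemma level_crossing (f : nat -> int) (i : int) (k l : nat) :
  (forall m, (k <= m < l)%N -> f m.+1 <= f m + 1) ->
  (k <= l)%N -> f k <= i -> i < f l ->
  exists m, [/\ (k <= m < l)%N, f m = i & f m.+1 = i + 1].
Proof.
elim: l => [|l IH] hf hkl hk hl.
  have e : k = 0%N by lia.
  by have := le_lt_trans hk hl; rewrite e ltxx.
have [e|ne] := eqVneq k l.+1; first by have := le_lt_trans hk hl; rewrite e ltxx.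
have hkl' : (k <= l)%N by lia.
have [hi|hi] := lerP (f l) i; last first.
  have [m [hm e1 e2]] := IH (fun m hm => hf m ltac:(lia)) hkl' hk hi.
  by exists m; split=> //; lia.
by exists l; have := hf l ltac:(lia); split; lia.
Qed.

(** * The labelled word *)

Definition step_labels {T : Type} (b : bool) (s : seq (bool * T)) : seq T :=
  [seq x.2 | x <- s & x.1 == b].

Lemma step_labels_cat (T : Type) (b : bool) (s t : seq (bool * T)) :
  step_labels b (s ++ t) = step_labels b s ++ step_labels b t.
Proof. by rewrite /step_labels filter_cat map_cat. Qed.

Lemma step_labels_flatten (T : Type) (b : bool) (s : seq (seq (bool * T))) :
  step_labels b (flatten s) = flatten [seq step_labels b x | x <- s].
Proof. by elim: s => //= x s IH; rewrite step_labels_cat IH. Qed.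

Lemma size_step_labels {T : Type} (b : bool) (s : seq (bool * T)) :
  size (step_labels b s) = count_mem b (unzip1 s).
Proof. by rewrite size_map size_filter count_map. Qed.

Lemma step_labels_map (I T : Type) (b : bool) (c : I -> bool) (g : I -> T)
    (P : pred I) (s : seq I) :
  step_labels b [seq (c k, g k) | k <- s & P k] =
  [seq g k | k <- s & (c k == b) && P k].
Proof. by rewrite /step_labels filter_map -filter_predI -map_comp. Qed.

(** * Valleys as adjacent labelled steps *)

Definition adjacent {T : Type} (x y : T) (s : seq T) : Prop :=
  exists s1 s2, s = s1 ++ [:: x, y & s2].

Definition ends_with {T : Type} (x : T) (s : seq T) : Prop :=
  exists s1, s = rcons s1 x.

(** Step numbers turn into positions in the lists of East and North labels, where valley labels are
    looked up. *)
Lemma inner_valley_unzip1 (T : Type) (L : seq (bool * T)) (i j : nat) :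
  inner_valley (unzip1 L) i j <->
  exists s t x y, [/\ L = s ++ [:: (east, x), (north, y) & t],
    i = (size (step_labels east s)).+1 & j = (size (step_labels north s)).+1].
Proof.
split=> [[s [t [e -> ->]]]|[s [t [x [y [-> -> ->]]]]]]; last first.
  by exists (unzip1 s), (unzip1 t); rewrite !size_step_labels /unzip1 map_cat.
have e1 : unzip1 (take (size s) L) = s.
  by rewrite /unzip1 map_take -/(unzip1 L) e take_size_cat.
have : unzip1 (drop (size s) L) = [:: east, north & t].
  by rewrite /unzip1 map_drop -/(unzip1 L) e drop_size_cat.
case eL : (drop (size s) L) => [|[x1 x] [|[y1 y] r]] //= [ex ey _].
exists (take (size s) L), r, x, y.
by rewrite !size_step_labels e1 -ex -ey -eL cat_take_drop.
Qed.

Lemma final_valley_unzip1 (T : Type) (L : seq (bool * T)) (i j : nat) :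
  final_valley (unzip1 L) i j <->
  exists x, [/\ ends_with (east, x) L,
    i = size (step_labels east L) & j = (size (step_labels north L)).+1].
Proof.
rewrite !size_step_labels; split=> [[s [e -> ->]]|[x [[s ->] -> ->]]]; last first.
  by exists (unzip1 s); rewrite /unzip1 map_rcons.
case: (lastP L) e => [|s' [b x]]; first by case: s.
rewrite /unzip1 map_rcons => /rcons_inj[_ /= ->].
by exists x; split=> //; exists s'.
Qed.

(* [D] is the window of d_C(pi,u), [E] and [N] are the labels of the East and
   North steps, and [M] the labels coming from the entries 0 of S^-_0. *)
Lemma valley_label_nth (n : nat) (D E N M : seq int) (i j : nat) :
  size D = n -> rev D = E ++ M -> N = rev D ++ [seq - x | x <- rev M] ->
  (i < size E)%N ->
  valley_label n (of_window D) i.+1 j.+1 =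
  (nth 0 E i, if (j < size N)%N then nth 0 N j
              else of_window D (n%:Z - j.+1%:Z)).
Proof.
move=> hD hr hN hi.
have hEM : (size E + size M = n)%N by rewrite -size_cat -hr size_rev.
have at_pos m : (m < n)%N -> of_window D (n%:Z + 1 - m.+1%:Z) = nth 0 (rev D) m.
  move=> hm; rewrite nth_rev ?hD //.
  have -> : n%:Z + 1 - m.+1%:Z = (n - m.+1).+1%:Z by lia.
  by rewrite /of_window /= mul1r.
rewrite /valley_label at_pos; last lia.
rewrite {1}hr nth_cat hi; congr (_, _).
rewrite hN size_cat size_rev hD size_map size_rev.
have [hj|hj] := ltnP j n.
  by rewrite at_pos // ltn_addr // nth_cat size_rev hD hj.
have [hj'|//] := ltnP j (n + size M).
rewrite nth_cat size_rev hD ltnNge hj /= (nth_map 0) ?size_rev ?ltn_subLR //.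
(* Past the first [n] North steps the argument is negative; by oddness the label is minus entry
   [j - n] of [D], whose first [size M] entries form [rev M]. *)
have -> : n%:Z - j.+1%:Z = - (j - n).+1%:Z by lia.
rewrite /of_window /= mulN1r; congr (- _).
rewrite -[D]revK hr rev_cat nth_cat size_rev; case: ifP => //; lia.
Qed.

(** The virtual North step after a final East step has number [n + size M + 1]. As [D] is [rev M]
    followed by [x] and the rest, the lookup hits [x] with a sign. *)
Lemma valley_label_final (n : nat) (D E M : seq int) (x : int) :
  size D = n -> rev D = rcons E x ++ M ->
  of_window D (n%:Z - (n + size M).+1%:Z) = - x.
Proof.
move=> hD hr; have -> : n%:Z - (n + size M).+1%:Z = - (size M).+1%:Z by lia.
rewrite /of_window /= mulN1r; congr (- _).
by rewrite -[D]revK hr rev_cat nth_cat size_rev ltnn subnn rev_rcons.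
Qed.

(** Looking up [D] at the two step numbers of a valley returns the labels that the steps carry in
    [L]; the virtual North step of a final valley gets the negated label of the last East step. *)
Lemma has_valley_labelledP (n : nat) (L : seq (bool * int)) (D M : seq int)
    (a b : int) :
  size D = n -> rev D = step_labels east L ++ M ->
  step_labels north L = rev D ++ [seq - x | x <- rev M] ->
  has_valley_labelled n (unzip1 L, of_window D) a b <->
  adjacent (east, a) (north, b) L \/
  (ends_with (east, a) L /\ b = - a).
Proof.
move=> hD hr hN.
have inner s t x y : L = s ++ [:: (east, x), (north, y) & t] ->
    valley_label n (of_window D) (size (step_labels east s)).+1
      (size (step_labels north s)).+1 = (x, y).
  move=> e; have hE : step_labels east L =
      step_labels east s ++ x :: step_labels east t.
    by rewrite e step_labels_cat.
  have hN' : step_labels north L =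
      step_labels north s ++ y :: step_labels north t.
    by rewrite e step_labels_cat.
  rewrite (valley_label_nth n D _ _ M _ _ hD hr hN) hE ?hN' ?size_cat /=; last lia.
  by rewrite !nth_cat !ltnn !subnn /= -{1}[size _]addn0 ltn_add2l.
have final x : ends_with (east, x) L ->
    valley_label n (of_window D) (size (step_labels east L))
      (size (step_labels north L)).+1 = (x, - x).
  move=> [s e]; have hE : step_labels east L = rcons (step_labels east s) x.
    by rewrite e -!cats1 step_labels_cat.
  rewrite {1}hE size_rcons (valley_label_nth n D _ _ M _ _ hD hr hN) hE ?size_rcons //.
  rewrite ltnn nth_rcons ltnn eqxx; congr (_, _).
  rewrite hN size_cat size_map !size_rev hD.
  by apply: (valley_label_final n D (step_labels east s)) => //; rewrite -hE.
split.
  move=> [i [j [[/inner_valley_unzip1 [s [t [x [y [e -> ->]]]]]|]]]] /=.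
    by rewrite (inner s t x y e) => -[<- <-]; left; exists s, t.
  by move=> /final_valley_unzip1 [x [e -> ->]]; rewrite (final x e) => -[<- <-]; right.
move=> [[s [t e]]|[e ->]].
  exists (size (step_labels east s)).+1, (size (step_labels north s)).+1.
  split; last exact: inner e.
  by left; apply/inner_valley_unzip1; exists s, t, a, b.
exists (size (step_labels east L)), (size (step_labels north L)).+1.
split; last exact: final.
by right; apply/final_valley_unzip1; exists a.
Qed.

(* Pairs (step, label) of the word S^-_i, resp. S^+_i.  Since [f] is [mu] read
   backwards, the reading directions are reversed with respect to [mu]. *)
Definition neg_block (n : nat) (f g : nat -> int) (i : nat) : seq (bool * int) :=
  [seq (f k == - i%:Z, - g k)
  | k <- iota 1 n & (f k == - i%:Z) || (f k == - i%:Z - 1)].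

Definition pos_block (n : nat) (f g : nat -> int) (i : nat) : seq (bool * int) :=
  [seq (f k == i%:Z, g k)
  | k <- rev (iota 1 n) & (f k == i%:Z) || (f k == i%:Z + 1)].

Definition labelled_zeta (n : nat) (f g : nat -> int) : seq (bool * int) :=
  flatten [seq neg_block n f g i ++ pos_block n f g i | i <- rev (iota 0 n.+1)].

Lemma read_map (I : Type) (x y : int) (f : I -> int) (s : seq I) :
  read x y (map f s) = [seq f k == x | k <- s & (f k == x) || (f k == y)].
Proof.
elim: s => //= k s; rewrite /read /= => ->.
by case ex: (f k == x); [|case: (f k == y)]; rewrite /= ?ex.
Qed.

Lemma zetaC_labelled (n : nat) (p : step_word) (g : nat -> int) :
  zetaC n p = unzip1 (labelled_zeta n (level p) g).
Proof.
rewrite /zetaC /unzip1 map_flatten -map_comp; congr flatten.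
apply: eq_map => i /=; rewrite map_cat -!map_comp mu_vec_level.
by congr (_ ++ _); rewrite /S_minus_left /S_plus_right ?map_rev ?revK -?map_rev read_map.
Qed.

(** * East and North labels compared with the window of d_C *)

Definition up_labels (n : nat) (f g : nat -> int) (i : nat) : seq int :=
  [seq g k | k <- rev (iota 1 n) & f k == i%:Z].

Definition down_labels (n : nat) (f g : nat -> int) (i : nat) : seq int :=
  [seq - g k | k <- iota 1 n & f k == - i%:Z].

Lemma north_labels (n : nat) (f g : nat -> int) :
  step_labels north (labelled_zeta n f g) =
  flatten [seq down_labels n f g i ++ up_labels n f g i | i <- rev (iota 0 n.+1)].
Proof.
rewrite step_labels_flatten -map_comp; congr flatten; apply: eq_map => i /=.
rewrite step_labels_cat !step_labels_map.
by congr (_ ++ _); congr map; apply: eq_filter => k; rewrite /north eqb_id; case: (f k == _).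
Qed.

(** The East entries of the words of index [i], namely -i-1 and i+1, are the North entries of the
    words of index [i.+1]. *)
Lemma east_labels (n : nat) (f g : nat -> int) :
  step_labels east (labelled_zeta n f g) =
  flatten [seq down_labels n f g i.+1 ++ up_labels n f g i.+1 | i <- rev (iota 0 n.+1)].
Proof.
rewrite step_labels_flatten -map_comp; congr flatten; apply: eq_map => i /=.
rewrite step_labels_cat !step_labels_map.
by congr (_ ++ _); congr map; apply: eq_filter => k; rewrite /east eqbF_neg; lia.
Qed.

Lemma rev_iotaS (m : nat) : rev (iota 0 m.+1) = m :: rev (iota 0 m).
Proof. by rewrite -addn1 iotaD rev_cat. Qed.

(** The window groups the entries -i with i+1, half-way between the North labels (-i with i) and the
    East labels (-i-1 with i+1); regrouping the lists links the three. *)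
Lemma rev_dC_window (n : nat) (p : step_word) (u : int -> int) :
  rev (dC_window n p u) =
  flatten [seq up_labels n (level p) (fun k : nat => u k) i.+1
               ++ down_labels n (level p) (fun k : nat => u k) i
          | i <- rev (iota 0 n.+1)].
Proof.
rewrite /dC_window rev_flatten -!map_rev -map_comp; congr flatten.
apply: eq_map => i /=; rewrite rev_cat -!map_rev -!filter_rev revK.
congr (_ ++ _); congr map; apply: eq_in_filter => k;
  rewrite ?mem_rev mem_iota => hk; rewrite mu_level //; lia.
Qed.

(* With [Y m] empty, this says that the East labels followed by those of the
   zero entries of S^-_0 are the window of d_C(pi,u) reversed. *)
Lemma flatten_shift_left (T : Type) (X Y : nat -> seq T) (m : nat) :
  flatten [seq Y i.+1 ++ X i.+1 | i <- rev (iota 0 m)] ++ Y 0%N =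
  Y m ++ flatten [seq X i.+1 ++ Y i | i <- rev (iota 0 m)].
Proof.
elim: m => [|m IH]; first by rewrite cats0.
by rewrite rev_iotaS /= -!catA IH.
Qed.

(** With [X m] empty, this says that the North labels are the reversed window followed by those of
    the zero entries of S^+_0. *)
Lemma flatten_shift_right (T : Type) (X Y : nat -> seq T) (m : nat) :
  X m ++ flatten [seq Y i ++ X i | i <- rev (iota 0 m)] =
  flatten [seq X i.+1 ++ Y i | i <- rev (iota 0 m)] ++ X 0%N.
Proof.
elim: m => [|m IH]; first by rewrite cats0.
by rewrite rev_iotaS /= -!catA IH.
Qed.

Lemma up_labels_nil (n : nat) (f g : nat -> int) (i : nat) :
  (forall k, (0 < k <= n)%N -> f k < i%:Z) -> up_labels n f g i = [::].
Proof.
move=> hf; rewrite /up_labels (@eq_in_filter _ _ pred0) ?filter_pred0 // => k.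
by rewrite mem_rev mem_iota => /hf /=; lia.
Qed.

Lemma down_labels_nil (n : nat) (f g : nat -> int) (i : nat) :
  (forall k, (0 < k <= n)%N -> - i%:Z < f k) -> down_labels n f g i = [::].
Proof.
move=> hf; rewrite /down_labels (@eq_in_filter _ _ pred0) ?filter_pred0 // => k.
by rewrite mem_iota => /hf /=; lia.
Qed.

Lemma count_split3 (T : Type) (P P1 P2 P3 : pred T) (s : seq T) :
  (forall x, P x = P1 x + P2 x + P3 x :> nat)%N ->
  count P s = (count P1 s + count P2 s + count P3 s)%N.
Proof. by move=> h; elim: s => //= x s ->; rewrite h; lia. Qed.

(** Passing from [m] to [m.+1] adds the entries -m and m+1, one new value at each end of the
    interval. At [m = n.+1] all [n] entries are counted. *)
Lemma size_shifted_labels (n : nat) (f g : nat -> int) (m : nat) :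
  size (flatten [seq up_labels n f g i.+1 ++ down_labels n f g i
                | i <- rev (iota 0 m)]) =
  count (fun k => - m%:Z < f k <= m%:Z) (iota 1 n).
Proof.
elim: m => [|m IH].
  by rewrite (@eq_count _ _ pred0) ?count_pred0 // => k /=; lia.
rewrite rev_iotaS /= !size_cat IH /up_labels /down_labels.
rewrite filter_rev map_rev size_rev !size_map !size_filter.
by symmetry; apply: count_split3 => k /=; lia.
Qed.

Lemma zetaC_vert_valleys (n : nat) (p : step_word) (u : int -> int) (a b : int) :
  lattice_path n n p ->
  let L := labelled_zeta n (level p) (fun k : nat => u k) in
  has_valley_labelled n (zetaC_vert n p u) a b <->
  adjacent (east, a) (north, b) L \/
  (ends_with (east, a) L /\ b = - a).
Proof.
move=> hp L; rewrite /zetaC_vert (zetaC_labelled n p (fun k : nat => u k)).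
have hb k : (k <= n)%N -> k%:Z - n%:Z <= level p k <= n%:Z by exact: level_bounds.
apply: (has_valley_labelledP n L _ (down_labels n (level p) (fun k : nat => u k) 0)).
- rewrite -size_rev rev_dC_window size_shifted_labels (@eq_in_count _ _ predT).
    by rewrite count_predT size_iota.
  by move=> k; rewrite mem_iota /= => hk; have := hb k; lia.
- rewrite rev_dC_window east_labels flatten_shift_left down_labels_nil // => k hk.
  by have := hb k; lia.
- rewrite rev_dC_window north_labels.
  (* The zero entries give North steps in both S^-_0 and S^+_0, with opposite labels and in opposite
     orders. *)
  have -> : [seq - x | x <- rev (down_labels n (level p) (fun k : nat => u k) 0)] =
      up_labels n (level p) (fun k : nat => u k) 0.
    rewrite /down_labels -map_rev -map_comp /up_labels filter_rev oppr0.
    by apply: eq_map => k /=; rewrite opprK.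
  rewrite -flatten_shift_right up_labels_nil // => k hk.
  by have := hb k; lia.
Qed.

(** * Consecutive steps of the labelled word *)

Lemma adjacent_rev (T : Type) (x y : T) (s : seq T) :
  adjacent x y (rev s) <-> adjacent y x s.
Proof.
have aux (t : seq T) (x' y' : T) : adjacent x' y' t -> adjacent y' x' (rev t).
  move=> [s1 [s2 ->]]; exists (rev s2), (rev s1).
  by rewrite rev_cat !rev_cons -!cats1 -!catA.
by split=> /aux //; rewrite revK.
Qed.

Lemma adjacent_map (T1 T2 : Type) (h : T1 -> T2) (x y : T2) (s : seq T1) :
  adjacent x y (map h s) <-> exists k l, [/\ adjacent k l s, h k = x & h l = y].
Proof.
split=> [[s1 [s2 e]]|[k [l [[s1 [s2 ->]] <- <-]]]]; last first.
  by exists (map h s1), (map h s2); rewrite map_cat.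
have : map h (drop (size s1) s) = [:: x, y & s2] by rewrite map_drop e drop_size_cat.
case e1 : (drop (size s1) s) => [|k [|l t]] //= [hk hl _].
by exists k, l; split=> //; exists (take (size s1) s), t; rewrite -e1 cat_take_drop.
Qed.

Lemma ends_with_map (T1 T2 : Type) (h : T1 -> T2) (x : T2) (s : seq T1) :
  ends_with x (map h s) <-> exists2 k, ends_with k s & h k = x.
Proof.
split=> [[s1]|[k [s1 ->] <-]]; last by exists (map h s1); rewrite map_rcons.
case: (lastP s) => [|t k]; first by case: s1.
by rewrite map_rcons => /rcons_inj[_ hk]; exists k => //; exists t.
Qed.

Lemma adjacent_cat (T : Type) (x y : T) (s t : seq T) :
  ~ ends_with x s -> adjacent x y (s ++ t) -> adjacent x y s \/ adjacent x y t.
Proof.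
elim: s => [|z s IH] hs; first by right.
move=> [[|z' s1] [s2 /= [ez e]]]; rewrite ez in hs *.
  case: s e hs {IH} => [|w s] /=; first by move=> _ []; exists nil.
  by move=> [-> _] _; left; exists nil, s.
have hs' : ~ ends_with x s by move=> [r er]; apply: hs; exists (z' :: r); rewrite er.
have [[r1 [r2 ->]]|] := IH hs' (ex_intro _ s1 (ex_intro _ s2 e)); last by right.
by left; exists (z' :: r1), r2.
Qed.

(** A pair straddling two blocks would have [x] at the end of a block; only the last block [t] may
    end so. *)
Lemma adjacent_flatten_cat (T : eqType) (x y : T) (ss : seq (seq T)) (t : seq T) :
  (forall s, s \in ss -> ~ ends_with x s) -> adjacent x y (flatten ss ++ t) ->
  (exists2 s, s \in ss & adjacent x y s) \/ adjacent x y t.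
Proof.
elim: ss => [|s ss IH] hss /=; first by right.
rewrite -catA => /(adjacent_cat _ x y) [].
- by apply: hss; rewrite mem_head.
- by left; exists s; rewrite ?mem_head.
move=> /IH [r hr|[r hr hr']|]; last by right.
  by apply: hss; rewrite inE hr orbT.
by left; exists r; rewrite // inE hr orbT.
Qed.

Lemma adjacent_flatten (T : eqType) (x y : T) (ss : seq (seq T)) (s : seq T) :
  s \in ss -> adjacent x y s -> adjacent x y (flatten ss).
Proof.
case/splitPr=> ss1 ss2 [s1 [s2 ->]].
by exists (flatten ss1 ++ s1), (s2 ++ flatten ss2); rewrite flatten_cat /= !catA -!catA.
Qed.

Lemma ends_with_cat (T : Type) (x : T) (s t : seq T) :
  t <> [::] -> ends_with x (s ++ t) -> ends_with x t.
Proof.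
case: (lastP t) => // r z _ [s1]; rewrite -rcons_cat => /rcons_inj[_ ->].
by exists r.
Qed.

Lemma pairwise_filter_iota (P : pred nat) (m n : nat) :
  pairwise ltn [seq k <- iota m n | P k].
Proof.
by rewrite -sorted_pairwise ?sorted_filter ?iota_ltn_sorted //; exact: ltn_trans.
Qed.

(** The filtered list is increasing, so an index satisfying [P] strictly between [k] and [l] would
    be listed between them. *)
Lemma adjacent_filter_iota (P : pred nat) (n k l : nat) :
  adjacent k l [seq k <- iota 1 n | P k] ->
  [/\ P k, P l, (0 < k < l)%N && (l <= n)%N
    & forall m, (k < m < l)%N -> ~~ P m].
Proof.
move=> [s1 [s2 e]].
have hm m : (m \in s1 ++ [:: k, l & s2]) = P m && (0 < m < 1 + n)%N.
  by rewrite -e mem_filter mem_iota.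
have := pairwise_filter_iota P 1 n; rewrite e pairwise_cat /=.
case/and5P=> h1 _ /andP[hkl hk] hl _.
have := hm k; rewrite mem_cat !inE eqxx orbT => /esym/andP[Pk ?].
have := hm l; rewrite mem_cat !inE eqxx !orbT => /esym/andP[Pl ?].
split=> //; first lia.
move=> m hmkl; apply/negP => Pm.
have := hm m; rewrite Pm mem_cat !inE (_ : (0 < m < 1 + n)%N); last lia.
case/or4P=> [ms1|/eqP|/eqP|ms2]; [|lia|lia|].
  by have := allrelP h1 m k ms1 (mem_head _ _) => /=; lia.
by have := allP hl m ms2 => /=; lia.
Qed.

Lemma adjacent_filter_iota_succ (P : pred nat) (n k : nat) :
  (0 < k < n)%N -> P k -> P k.+1 -> adjacent k k.+1 [seq k <- iota 1 n | P k].
Proof.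
move=> hk Pk Pk'.
exists [seq k <- iota 1 k.-1 | P k], [seq k <- iota k.+2 (n - k.+1) | P k].
have -> : iota 1 n = iota 1 k.-1 ++ [:: k, k.+1 & iota k.+2 (n - k.+1)].
  have {1}-> : n = (k.-1 + (n - k.+1).+2)%N by lia.
  by rewrite iotaD /= add1n prednK //; lia.
by rewrite filter_cat /= Pk Pk'.
Qed.

Lemma ends_with_filter_iota (P : pred nat) (n k : nat) :
  ends_with k [seq k <- iota 1 n | P k] ->
  [/\ P k, (0 < k <= n)%N & forall m, (k < m <= n)%N -> ~~ P m].
Proof.
move=> [s e]; have hm m : (m \in rcons s k) = P m && (0 < m < 1 + n)%N.
  by rewrite -e mem_filter mem_iota.
have := pairwise_filter_iota P 1 n; rewrite e pairwise_rcons => /andP[/allP h1 _].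
have := hm k; rewrite mem_rcons mem_head => /esym/andP[Pk ?].
split=> // m hkm; apply/negP => Pm.
have := hm m; rewrite Pm mem_rcons inE (_ : (0 < m < 1 + n)%N); last lia.
by case/orP=> [/eqP|/h1 /=]; lia.
Qed.

Lemma ends_with_rev_filter_iota (P : pred nat) (n k : nat) :
  ends_with k [seq k <- rev (iota 1 n) | P k] ->
  [/\ P k, (0 < k <= n)%N & forall m, (0 < m < k)%N -> ~~ P m].
Proof.
rewrite filter_rev => -[s /(congr1 rev)]; rewrite revK rev_rcons => e.
have hm m : (m \in k :: rev s) = P m && (0 < m < 1 + n)%N.
  by rewrite -e mem_filter mem_iota.
have := pairwise_filter_iota P 1 n; rewrite e /= => /andP[/allP h1 _].
have := hm k; rewrite mem_head => /esym/andP[Pk ?].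
split=> // m hkm; apply/negP => Pm.
have := hm m; rewrite Pm inE (_ : (0 < m < 1 + n)%N); last lia.
by case/orP=> [/eqP|/h1 /=]; lia.
Qed.

(** * Endings and valleys of the words S^-_i and S^+_i *)

(** After an entry -i-1 the sequence must still climb to f(n) >= 0, hence meets -i at a later index,
    which is read later. *)
Lemma neg_block_end (n : nat) (f g : nat -> int) (i : nat) (x : int) :
  (forall k, (k < n)%N -> f k.+1 <= f k + 1) -> 0 <= f n ->
  ~ ends_with (east, x) (neg_block n f g i).
Proof.
move=> hstep hn /ends_with_map[k /ends_with_filter_iota[Pk hk hlast]] [/negbT ek _].
have fk : f k = - i%:Z - 1 by move: Pk ek; lia.
have [m [hm e1 e2]] : exists m, [/\ (k <= m < n)%N, f m = - i%:Z - 1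
    & f m.+1 = - i%:Z - 1 + 1].
  by apply: level_crossing => [m hm|||]; [apply: hstep|..]; lia.
by have := hlast m.+1; rewrite e2; lia.
Qed.

(** Indices are read downwards, so the last one is the smallest. Climbing from f(0) <= 0 to i+1
    passes through i at an earlier index, which must be 0. *)
Lemma pos_block_end (n : nat) (f g : nat -> int) (i : nat) (x : int) :
  f 0%N <= 0 -> (forall k, (k < n)%N -> f k.+1 <= f k + 1) ->
  ends_with (east, x) (pos_block n f g i) -> [/\ i = 0%N, f 1%N = 1 & x = g 1%N].
Proof.
move=> h0 hstep /ends_with_map[k /ends_with_rev_filter_iota[Pk hk hfirst]].
move=> [/negbT ek gk].
have fk : f k = i%:Z + 1 by move: Pk ek; lia.
have [m [hm e1 e2]] : exists m, [/\ (0 <= m < k)%N, f m = i%:Z & f m.+1 = i%:Z + 1].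
  by apply: level_crossing => [m hm|||]; [apply: hstep|..]; lia.
(* A positive [m] would belong to the block and precede [k], against the minimality of [k]. *)
have m0 : m = 0%N by have := hfirst m; rewrite e1; lia.
move: e1 e2; rewrite m0 => e1 e2.
have k1 : k = 1%N by have := hfirst 1%N; rewrite e2; lia.
by split; [lia|rewrite e2; lia|rewrite -gk k1].
Qed.

(** Strictly between consecutive indices [k < l] of the block neither value is taken, so the unit
    climb found by [level_crossing] starts at [k] and ends at [l]. *)
Lemma neg_block_adjacent (n : nat) (f g : nat -> int) (i : nat) (x y : int) :
  (forall k, (k < n)%N -> f k.+1 <= f k + 1) ->
  adjacent (east, x) (north, y) (neg_block n f g i) <->
  exists k, [/\ (0 < k < n)%N, f k = - i%:Z - 1, f k.+1 = - i%:Z, x = - g k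
              & y = - g k.+1].
Proof.
move=> hstep; rewrite adjacent_map; split.
  move=> [k [l [/adjacent_filter_iota[Pk Pl hkl hbetween]]]].
  move=> [/negbT ek gk] [el gl].
  have fl : f l = - i%:Z := eqP el.
  have fk : f k = - i%:Z - 1 by move: Pk ek; lia.
  have [m [hm e1 e2]] : exists m, [/\ (k <= m < l)%N, f m = - i%:Z - 1
      & f m.+1 = - i%:Z - 1 + 1].
    by apply: level_crossing => [m hm|||]; [apply: hstep|..]; lia.
  have mk : m = k by have := hbetween m; rewrite e1; lia.
  have lk : l = k.+1 by rewrite -mk; have := hbetween m.+1; rewrite e2; lia.
  by rewrite lk in fl gl; exists k; rewrite -gk -gl; split=> //; lia.
move=> [k [hk e1 e2 -> ->]]; exists k, k.+1; split.
- by apply: adjacent_filter_iota_succ; rewrite ?e1 ?e2 ?eqxx ?orbT.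
- by rewrite e1; congr (_, _); apply/negbTE; lia.
- by rewrite e2 eqxx.
Qed.

(** As for [neg_block_adjacent], but read downwards: the East step comes from the larger index,
    which swaps the two labels. *)
Lemma pos_block_adjacent (n : nat) (f g : nat -> int) (i : nat) (x y : int) :
  (forall k, (k < n)%N -> f k.+1 <= f k + 1) ->
  adjacent (east, x) (north, y) (pos_block n f g i) <->
  exists k, [/\ (0 < k < n)%N, f k = i%:Z, f k.+1 = i%:Z + 1, x = g k.+1 & y = g k].
Proof.
move=> hstep; rewrite /pos_block filter_rev map_rev adjacent_rev adjacent_map; split.
  move=> [k [l [/adjacent_filter_iota[Pk Pl hkl hbetween]]]].
  move=> [ek gk] [/negbT el gl]; have fk : f k = i%:Z := eqP ek.
  have fl : f l = i%:Z + 1 by move: Pl el; lia.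
  have [m [hm e1 e2]] : exists m, [/\ (k <= m < l)%N, f m = i%:Z & f m.+1 = i%:Z + 1].
    by apply: level_crossing => [m hm|||]; [apply: hstep|..]; lia.
  have mk : m = k by have := hbetween m; rewrite e1; lia.
  have lk : l = k.+1 by rewrite -mk; have := hbetween m.+1; rewrite e2; lia.
  by rewrite lk in fl gl; exists k; rewrite -gk -gl; split=> //; lia.
move=> [k [hk e1 e2 -> ->]]; exists k, k.+1; split.
- by apply: adjacent_filter_iota_succ; rewrite ?e1 ?e2 ?eqxx ?orbT.
- by rewrite e1 eqxx.
- by rewrite e2; congr (_, _); apply/negbTE; lia.
Qed.

(** Isolates S^+_0, the only word that can end with an East step, in the form required by
    [adjacent_flatten_cat]. *)
Lemma labelled_zeta_split (n : nat) (f g : nat -> int) :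
  labelled_zeta n f g =
  flatten (rcons (flatten [seq [:: neg_block n f g i; pos_block n f g i]
                          | i <- rev (iota 1 n)]) (neg_block n f g 0))
  ++ pos_block n f g 0.
Proof.
rewrite /labelled_zeta /= rev_cons map_rcons !flatten_rcons -!catA.
by congr (_ ++ _); elim: (rev _) => //= i s ->; rewrite !catA.
Qed.

Lemma labelled_zeta_adjacent (n : nat) (f g : nat -> int) (x y : int) :
  f 0%N <= 0 -> (forall k, (k < n)%N -> f k.+1 <= f k + 1) -> 0 <= f n ->
  (forall k, (k <= n)%N -> - n%:Z <= f k <= n%:Z) ->
  adjacent (east, x) (north, y) (labelled_zeta n f g) <->
  exists k, [/\ (0 < k < n)%N, f k.+1 = f k + 1
              & (0 <= f k /\ (x, y) = (g k.+1, g k)) \/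
                (f k < 0 /\ (x, y) = (- g k, - g k.+1))].
Proof.
move=> h0 hstep hn hb; split.
  have neg i : adjacent (east, x) (north, y) (neg_block n f g i) ->
      exists k, [/\ (0 < k < n)%N, f k.+1 = f k + 1
              & (0 <= f k /\ (x, y) = (g k.+1, g k)) \/
                (f k < 0 /\ (x, y) = (- g k, - g k.+1))].
    move=> /(neg_block_adjacent _ _ _ _ _ _ hstep)[k [hk e1 e2 -> ->]].
    by exists k; split=> //; [lia|right; split=> //; lia].
  have pos i : adjacent (east, x) (north, y) (pos_block n f g i) ->
      exists k, [/\ (0 < k < n)%N, f k.+1 = f k + 1
              & (0 <= f k /\ (x, y) = (g k.+1, g k)) \/
                (f k < 0 /\ (x, y) = (- g k, - g k.+1))].
    move=> /(pos_block_adjacent _ _ _ _ _ _ hstep)[k [hk e1 e2 -> ->]].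
    by exists k; split=> //; [lia|left; split=> //; lia].
  rewrite labelled_zeta_split => /(adjacent_flatten_cat _ _ _) [s||].
  - rewrite mem_rcons inE => /predU1P[->|/flatten_mapP[i]]; first exact: neg_block_end.
    rewrite mem_rev mem_iota !inE => hi /pred2P[] ->; first exact: neg_block_end.
    (* [pos_block_end] forces [i = 0], whereas [i] ranges over 1, ..., n here. *)
    by move=> /(pos_block_end _ _ _ _ _ h0 hstep)[]; lia.
  - move=> [s]; rewrite mem_rcons inE => /predU1P[->|/flatten_mapP[i _]]; first exact: neg.
    by rewrite !inE => /pred2P[] ->; [apply: neg|apply: pos].
  - exact: pos.
move=> [k [hk e h]].
have hbk := hb k ltac:(lia).
have mem_block i : (i <= n)%N ->
    neg_block n f g i ++ pos_block n f g i \in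
    [seq neg_block n f g i ++ pos_block n f g i | i <- rev (iota 0 n.+1)].
  by move=> hi; apply: map_f; rewrite mem_rev mem_iota; lia.
case: h => -[hsign [-> ->]].
  apply: adjacent_flatten (mem_block `|f k|%N ltac:(lia)) _.
  have [|s1 [s2 ->]] := iffRL (pos_block_adjacent n f g `|f k| (g k.+1) (g k) hstep).
    by exists k; split=> //; lia.
  by exists (neg_block n f g `|f k| ++ s1), s2; rewrite catA.
(* A climb from a negative value -q-1 to -q is recorded in S^-_q; a climb from a nonnegative value
   was found in S^+ of that index. *)
have [q fk] : exists q : nat, f k = - q%:Z - 1 by exists `|(f k + 1)%R|%N; lia.
apply: adjacent_flatten (mem_block q ltac:(lia)) _.
have [|s1 [s2 ->]] := iffRL (neg_block_adjacent n f g q (- g k) (- g k.+1) hstep).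
  by exists k; split=> //; lia.
by exists s1, (s2 ++ pos_block n f g q); rewrite -catA.
Qed.

Lemma labelled_zeta_end (n : nat) (f g : nat -> int) (x : int) :
  (0 < n)%N -> f 0%N <= 0 -> (forall k, (k < n)%N -> f k.+1 <= f k + 1) -> 0 <= f n ->
  ends_with (east, x) (labelled_zeta n f g) <-> f 1%N = 1 /\ x = g 1%N.
Proof.
move=> n0 h0 hstep hn; rewrite labelled_zeta_split; split=> [|[f1 ->]]; last first.
  rewrite /pos_block -{5}[n]prednK // /= rev_cons filter_rcons f1 /= map_rcons f1.
  by rewrite -rcons_cat; eexists.
(* Such a [k] makes S^+_0 nonempty, so that the whole word ends as S^+_0 does. *)
have [k hk fk] : exists2 k, (0 < k <= n)%N & (f k == 0) || (f k == 1).
  have [e|ne] := eqVneq (f n) 0; first by exists n; rewrite ?e // n0 leqnn.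
  have [m [hm e1 e2]] : exists m, [/\ (0 <= m < n)%N, f m = 0 & f m.+1 = 0 + 1].
    by apply: level_crossing => [m hm|||]; [apply: hstep|..]; lia.
  by exists m.+1; rewrite ?e2.
move=> hL; have [|_ //] := pos_block_end n f g 0 x h0 hstep.
apply: ends_with_cat hL => /(congr1 size)/eqP; rewrite size_map size_eq0 => /eqP hnil.
have : k \in [seq k <- rev (iota 1 n) | (f k == 0%:Z) || (f k == 0%:Z + 1)].
  by rewrite mem_filter mem_rev mem_iota fk.
by rewrite hnil.
Qed.

(** By oddness and injectivity the two positive indices would be opposite. This separates labels
    coming from S^+ from those coming from S^-. *)
Lemma window_value_opp (n : nat) (u : int -> int) (a : int) :
  signed_perm n u -> window_value n u a -> ~ window_value n u (- a).
Proof.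
move=> [_ hinj _ hodd] [i [hi <-]] [j [hj e]].
have : j%:Z = - i%:Z.
  by apply: hinj; rewrite ?inE ?e ?hodd ?inE //; lia.
lia.
Qed.

Theorem theorem4p20 (n : nat) (hn : (1 <= n)%N)
    (p : step_word) (u : int -> int) (hpu : vertC n p u)
    (a b : int) (ha : window_value n u a) (hb : window_value n u b) :
  (has_rise_labelled p u a b <->
     (has_valley_labelled n (zetaC_vert n p u) b a \/
      has_valley_labelled n (zetaC_vert n p u) (- a) (- b)))
  /\
  ((begins_north p /\ u 1 = a) <->
     has_valley_labelled n (zetaC_vert n p u) a (- a)).
Proof.
case: hpu => hp hu _ _.
pose f := level p; pose g := fun k : nat => u k.
have h0 : f 0%N <= 0 by exact: level0_le.
have hstep k : (k < n)%N -> f k.+1 <= f k + 1 by exact: level_step.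
have hbd k : (k <= n)%N -> k%:Z - n%:Z <= f k <= n%:Z by exact: level_bounds.
have hlast : 0 <= f n by have := hbd n; lia.
have hbd' k : (k <= n)%N -> - n%:Z <= f k <= n%:Z by move=> /hbd; lia.
have win k : (0 < k <= n)%N -> window_value n u (g k) by exists k.
have opp c d : window_value n u c -> window_value n u d -> c = - d -> False.
  by move=> hc hd e; apply: (window_value_opp n u d hu hd); rewrite -e.
have valleyP x y : has_valley_labelled n (zetaC_vert n p u) x y <->
    (exists k, [/\ (0 < k < n)%N, f k.+1 = f k + 1
       & (0 <= f k /\ (x, y) = (g k.+1, g k)) \/
         (f k < 0 /\ (x, y) = (- g k, - g k.+1))]) \/
    ((f 1%N = 1 /\ x = g 1%N) /\ y = - x).
  by rewrite zetaC_vert_valleys // labelled_zeta_adjacent // labelled_zeta_end.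
rewrite !valleyP (begins_north_level n) //; split; split.
- move=> [k [/(rise_level n p k hp)[k0 kn e] [<- <-]]].
  have hk : (0 < k < n)%N by rewrite k0.
  (* The sign of f(k) decides between the valley (b,a) in a word S^+ and the valley (-a,-b) in a
     word S^-. *)
  by case: (lerP 0 (f k)) => hk0; [left|right]; left; exists k; split=> //; [left|right].
- have rise_of k : (0 < k < n)%N -> f k.+1 = f k + 1 -> a = g k -> b = g k.+1 ->
      has_rise_labelled p u a b.
    move=> /andP[k0 kn] e -> ->; exists k; split=> //.
    exact/(rise_level n p k hp).
  (* Of the six cases, only (b,a) in a word S^+ and (-a,-b) in a word S^- survive; each other one
     equates a window value with the opposite of another. *)
  case=> -[[k [hk e [[_ [e1 e2]]|[_ [e1 e2]]]]]|[[_ e1] e2]].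
  + exact: (rise_of k).
  + by case: (opp b (g k)) => //; apply: win; lia.
  + by case: (opp a b).
  + by case: (opp (g k.+1) a) => //; apply: win; lia.
  + by apply: (rise_of k) => //; apply: oppr_inj.
  + by case: (opp (g 1%N) a) => //; apply: win; lia.
- by move=> [f1 <-]; right.
(* An inner valley has both labels in u([n]) or both in its negative, so (a,-a) can only label the
   final valley. *)
- case=> [[k [hk e [[_ [e1 e2]]|[_ [e1 e2]]]]]|[[f1 ->] _]] //.
  + by case: (opp (g k) a) => //; apply: win; lia.
  + by case: (opp a (g k)) => //; apply: win; lia.
Qed.
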